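(* Let $a\in\mathbb{R}$, let $M,N\subsetneq\mathbb{R}$ be neutrices, let $\varphi:\mathbb{R}\to\mathbb{R}$ be $M$-differentiable at $a$, and let $F:X\to\mathbb{E}$ be a flexible function with $X\subseteq\mathbb{R}$. Put $b=\varphi(a)$. Assume that $b$ is an $N$-interior point of $X$, that $\lim_{x\to a+M}\varphi(x)=b+N$, that $\varphi(x)\notin b+N$ for all $x$ in some outer $M$-neighborhood $U\subseteq X$ of $a$, and that $F$ is $N$-differentiable at $b$. If $D_M\varphi(a)$ or $D_NF(b)$ is zeroless, then $$D_M(F\circ\varphi)(a)\subseteq D_NF(b)\,D_M\varphi(a).$$
   Context: Setting: Nelson's Internal Set Theory IST, together with external sets (in the sense of Kanovei and Reeken). External numbers. A (scalar) neutrix is a (possibly external) convex additive subgroup of $\mathbb{R}$; by convention all neutrices are different from $\mathbb{R}$. An external number is a set $\alpha=a+A=\{a+x: x\in A\}$ with $a\in\mathbb{R}$ and $A$ a neutrix; $\mathrm{N}(\alpha)=A$ is its neutrix part. $\mathbb{E}$ is the class of external numbers; real numbers ($A=\{0\}$) and neutrices are external numbers. $\alpha$ is zeroless if $0\notin\alpha$. For $\alpha=a+A,\beta=b+B$: $\alpha\pm\beta=a\pm b+\max\{A,B\}$ (max for inclusion), $\alpha\beta=ab+\max\{aB,bA,AB\}$; for a non-zero real $h$, $\alpha/h=a/h+A/h$. $|\alpha|=|a|+A$. $\alpha<\beta$ (equivalently $\beta>\alpha$) iff $s<t$ for all $s\in\alpha,t\in\beta$; in particular, for real $r$ and a neutrix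 $M$, $r>M$ means that $r$ exceeds all elements of $M$. Flexible functions. A flexible function is a map $F:X\to\mathbb{E}$ whose graph is definable in IST; it is assumed to have a (not necessarily internal) representative $f:X\to\mathbb{R}$, so $F(x)=f(x)+\mathrm{N}(F(x))$. Real-valued functions are special cases. Neighborhoods. An $M$-neighborhood of $a+M$ is an internal set $V\subseteq\mathbb{R}$ containing $(a-r,a+r)$ for some real $r>M$; an outer $M$-neighborhood of $a$ is a set $V\setminus(a+M)$ with $V$ an $M$-neighborhood of $a+M$. $b$ is an $N$-interior point of $X$ if $X$ contains an $N$-neighborhood of $b+N$. Outer limits. For a neutrix $K$, $\alpha\in\mathbb{E}$ satisfies $K\text{-}\lim_{x\to a+M}H(x)=\alpha$ if for every real $\varepsilon>K$ there is $\delta>M$ such that $|H(x)-\alpha|<\varepsilon$ for all $x$ in the domain of $H$ with $M<|x-a|<\delta$. The $M$-outer limit $\lim_{x\to a+M}H(x)$ is the intersection of all $\alpha\in\mathbb{E}$ such that $\mathrm{N}(\alpha)\text{-}\lim_{x\to a+M}H(x)=\alpha$; it exists if there is at least one such $\alpha$, and it is then an external number. $M$-derivative. $D_MH(a)=\lim_{x\to a+M}\frac{H(x)-H(a)}{x-a}$; $H$ is $M$-differentiable at $a$ if this limit exists. Similarly with $N$ in place of $M$. *)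

(* Defs.v *)
From HB Require Import structures.
From mathcomp Require Import all_boot all_order all_algebra.
From mathcomp Require Import boolp classical_sets.

Set Implicit Arguments.
Unset Strict Implicit.
Unset Printing Implicit Defensive.

Import Order.TTheory GRing.Theory Num.Theory.

Local Open Scope classical_set_scope.
Local Open Scope ring_scope.

(* De Bruijn indices: FAll f binds index 0 of f. *)
Inductive formula : Type :=
  | FMem of nat & nat
  | FEq of nat & nat
  | FSt of nat
  | FFalse
  | FImp of formula & formula
  | FAll of formula.

Fixpoint internal_formula (f : formula) : bool :=
  match f with
  | FSt _ => false
  | FImp g h => internal_formula g && internal_formula h
  | FAll g => internal_formula g
  | _ => true
  end.

Definition scons (U : Type) (x : U) (e : nat -> U) : nat -> U :=
  fun n => if n is m.+1 then e m else x.

Section Semantics.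
Variables (U : Type) (mem : U -> U -> Prop) (st : U -> Prop).

Fixpoint sat (e : nat -> U) (f : formula) : Prop :=
  match f with
  | FMem i j => mem (e i) (e j)
  | FEq i j => e i = e j
  | FSt i => st (e i)
  | FFalse => False
  | FImp g h => sat e g -> sat e h
  | FAll g => forall x, sat (scons x e) g
  end.

Definition is_sub (x y : U) : Prop := forall z, mem z x -> mem z y.

Definition is_upair (p x y : U) : Prop := forall z, mem z p <-> z = x \/ z = y.

(* Kuratowski pair {{x}, {x, y}} *)
Definition is_pair (p x y : U) : Prop :=
  forall z, mem z p <-> is_upair z x x \/ is_upair z x y.

(* Tarski finiteness: every nonempty family of subsets of z has a minimal
   element for inclusion (in ZFC, the usual finiteness). *)
Definition is_finite (z : U) : Prop :=
  forall F, (forall s, mem s F -> is_sub s z) -> (exists s, mem s F) ->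
    exists2 m, mem m F & forall s, mem s F -> is_sub s m -> s = m.

Definition rel2 (g x y : U) : Prop := exists2 p, is_pair p x y & mem p g.

Definition rel3 (g x y z : U) : Prop :=
  exists p q, [/\ is_pair p x y, is_pair q p z & mem q g].

Record ZFC_axioms : Prop := {
  zfc_ext : forall x y, (forall z, mem z x <-> mem z y) -> x = y;
  zfc_pairing : forall x y, exists p, is_upair p x y;
  zfc_union : forall x, exists u, forall z,
    mem z u <-> exists2 y, mem y x & mem z y;
  zfc_power : forall x, exists p, forall z, mem z p <-> is_sub z x;
  zfc_infinity : exists w,
    (exists2 e, mem e w & forall z, ~ mem z e) /\
    (forall x, mem x w ->
       exists2 s, mem s w & forall z, mem z s <-> mem z x \/ z = x);
  zfc_foundation : forall x, (exists y, mem y x) ->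
    exists2 y, mem y x & forall z, ~ (mem z y /\ mem z x);
  zfc_separation : forall f e x, internal_formula f ->
    exists y, forall z, mem z y <-> mem z x /\ sat (scons z e) f;
  zfc_replacement : forall f e x, internal_formula f ->
    (forall u, mem u x -> exists! v, sat (scons u (scons v e)) f) ->
    exists y, forall v,
      mem v y <-> exists2 u, mem u x & sat (scons u (scons v e)) f;
  zfc_choice : forall x,
    (forall y, mem y x -> exists z, mem z y) ->
    (forall y y' z, mem y x -> mem y' x -> mem z y -> mem z y' -> y = y') ->
    exists c, forall y, mem y x -> exists! z, mem z y /\ mem z c
}.

Record IST_axioms : Prop := {
  ist_zfc : ZFC_axioms;
  ist_transfer : forall f e, internal_formula f -> (forall n, st (e n)) ->
    (forall x, st x -> sat (scons x e) f) -> forall x, sat (scons x e) f;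
  ist_idealization : forall f e, internal_formula f ->
    (forall z, st z -> is_finite z ->
       exists x, forall y, mem y z -> sat (scons x (scons y e)) f) <->
    (exists x, forall y, st y -> sat (scons x (scons y e)) f);
  ist_standardization : forall f e x, st x ->
    exists2 y, st y &
      forall z, st z -> (mem z y <-> mem z x /\ sat (scons z e) f)
}.

End Semantics.

(* Theorems of IST are stated as assertions about every model of IST. *)
Record ist_model : Type := {
  univ :> Type;
  imem : univ -> univ -> Prop;
  ist : univ -> Prop;
  ist_modelP : IST_axioms imem ist
}.

(* The carrier is the set of all reals, standard or not, of the model: it is in
   bijection with the elements of a standard set of the model, its operations
   and order are standard sets of the model, and it is Dedekind complete for the
   sets of the model (internal sets), which determines it up to a standard
   isomorphism. It is not complete for external sets. *)
Record ist_reals (I : ist_model) : Type := {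
  ireal :> realFieldType;
  rset : I; radd : I; rmul : I; rle : I;
  emb : ireal -> I;
  emb_inj : injective emb;
  rset_st : ist rset; radd_st : ist radd; rmul_st : ist rmul; rle_st : ist rle;
  rsetP : forall u : I, imem u rset <-> exists x, u = emb x;
  raddP : forall x y z : ireal,
    rel3 (@imem I) radd (emb x) (emb y) (emb z) <-> x + y = z;
  rmulP : forall x y z : ireal,
    rel3 (@imem I) rmul (emb x) (emb y) (emb z) <-> x * y = z;
  rleP : forall x y : ireal, rel2 (@imem I) rle (emb x) (emb y) <-> x <= y;
  rcomplete : forall u : I,
    (exists x, imem (emb x) u) ->
    (exists b, forall x, imem (emb x) u -> x <= b) ->
    exists2 s, (forall x, imem (emb x) u -> x <= s) &
      forall b, (forall x, imem (emb x) u -> x <= b) -> s <= b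
}.

Section ExternalNumbers.
Variables (I : ist_model) (R : ist_reals I).

Definition internal_set (A : set R) : Prop :=
  exists u : I, forall x, A x <-> imem (emb x) u.

(* Possibly external sets are the classes definable in IST, parameters allowed
   (through the environment e). *)
Definition definable (A : set R) : Prop :=
  exists f (e : nat -> I),
    forall x, A x <-> sat (@imem I) (@ist I) (scons (emb x) e) f.

Definition definable2 (G : R -> R -> Prop) : Prop :=
  exists f (e : nat -> I), forall x y,
    G x y <-> sat (@imem I) (@ist I) (scons (emb x) (scons (emb y) e)) f.

Definition set_lt (A B : set R) : Prop := forall s t, A s -> B t -> s < t.

Record neutrix (A : set R) : Prop := {
  neutrix_def : definable A;
  neutrix0 : A 0;
  neutrixB : forall x y, A x -> A y -> A (x - y);
  neutrix_convex : forall x y z, A x -> A y -> x <= z <= y -> A z;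
  neutrix_proper : A <> setT
}.

(* A presentation a + A; two presentations denote the same external number when
   they have the same underlying set. *)
Record extnum : Type := ExtNum { rep : R; neut : set R }.

Definition eset (al : extnum) : set R := [set rep al + x | x in neut al].

Definition external_number (al : extnum) : Prop := neutrix (neut al).

Definition zeroless (al : extnum) : Prop := ~ eset al 0.

Definition ereal (x : R) : extnum := ExtNum x [set 0].

Definition nscale (x : R) (A : set R) : set R := [set x * y | y in A].

Definition nprod (A B : set R) : set R := [set x * y | x in A & y in B].

(* Neutrices are totally ordered by inclusion, so their maximum is their union. *)
Definition nmax (A B : set R) : set R := A `|` B.

Definition esub (al be : extnum) : extnum :=
  ExtNum (rep al - rep be) (nmax (neut al) (neut be)).

Definition emul (al be : extnum) : extnum :=
  ExtNum (rep al * rep be)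
    (nmax (nscale (rep al) (neut be))
       (nmax (nscale (rep be) (neut al)) (nprod (neut al) (neut be)))).

Definition edivr (al : extnum) (h : R) : extnum :=
  ExtNum (rep al / h) (nscale h^-1 (neut al)).

Definition eabs (al : extnum) : extnum := ExtNum `|rep al| (neut al).

(* A flexible function X -> E is given by X and a total H : R -> extnum whose
   values outside X are irrelevant; [rep \o H] is its representative. The graph
   is {(x, y) | x in X, y in H x}. *)
Record flexible (X : set R) (H : R -> extnum) : Prop := {
  flexible_val : forall x, X x -> external_number (H x);
  flexible_graph : definable2 (fun x y => X x /\ eset (H x) y);
  flexible_rep : definable2 (fun x y => X x /\ y = rep (H x))
}.

Definition real_fun (f : R -> R) : R -> extnum := fun x => ereal (f x).

Definition neighborhood (M : set R) (a : R) (V : set R) : Prop :=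
  internal_set V /\
  exists2 r, set_lt M [set r] & forall x, a - r < x < a + r -> V x.

Definition outer_neighborhood (M : set R) (a : R) (U : set R) : Prop :=
  exists2 V, neighborhood M a V & U = V `\` eset (ExtNum a M).

Definition interior_point (N : set R) (b : R) (X : set R) : Prop :=
  exists2 V, neighborhood N b V & V `<=` X.

Definition nlimit (K : set R) (X : set R) (H : R -> extnum) (a : R)
    (M : set R) (al : extnum) : Prop :=
  forall eps : R, set_lt K [set eps] ->
    exists2 delta : R, set_lt M [set delta] &
      forall x, X x -> set_lt M [set `|x - a|] -> `|x - a| < delta ->
        set_lt (eset (eabs (esub (H x) al))) [set eps].

Definition outer_limit_candidate (X : set R) (H : R -> extnum) (a : R)
    (M : set R) : set extnum :=
  [set al | external_number al /\ nlimit (neut al) X H a M al].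

Definition outer_limit_exists (X : set R) (H : R -> extnum) (a : R)
    (M : set R) : Prop :=
  exists al, outer_limit_candidate X H a M al.

Definition outer_limit (X : set R) (H : R -> extnum) (a : R) (M : set R) :
    set R :=
  \bigcap_(al in outer_limit_candidate X H a M) eset al.

Definition diff_quot (H : R -> extnum) (a : R) : R -> extnum :=
  fun x => edivr (esub (H x) (H a)) (x - a).

Definition diff_quot_dom (X : set R) (a : R) : set R :=
  [set x | X x /\ x <> a].

Definition differentiable (M : set R) (X : set R) (H : R -> extnum) (a : R) :
    Prop :=
  X a /\ outer_limit_exists (diff_quot_dom X a) (diff_quot H a) a M.

Definition derivative (M : set R) (X : set R) (H : R -> extnum) (a : R) :
    set R :=
  outer_limit (diff_quot_dom X a) (diff_quot H a) a M.

End ExternalNumbers.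

(* Main.v *)
Require Import Defs.
From HB Require Import structures.
From mathcomp Require Import all_boot all_order all_algebra.
From mathcomp Require Import boolp classical_sets.
From mathcomp Require Import ring lra.

Set Implicit Arguments.
Unset Strict Implicit.
Unset Printing Implicit Defensive.

Import Order.TTheory GRing.Theory Num.Theory.
Local Open Scope classical_set_scope.
Local Open Scope ring_scope.

(** Why the chain rule holds.  Near [a], outside [a + M], the point [phi x] lies
outside [phi a + N], so the difference quotient of the composite is the
product [q * p] of a quotient [q] of [F] at [phi x] and a quotient [p] of [phi]
at [x].  With [c] and [d] representatives of the derivatives of [F] and [phi],
[q p - c d = (q - c) (p - d) + c (p - d) + d (q - c)]; hence, if
[|p - d| < e1] and [|q - c| < e2], the error is at most
[e1 e2 + |c| e1 + |d| e2] (lemma [chain_estimate]).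

The neutrix of the product is the largest of [c K1], [d K2] and [K1 K2], where
[K1], [K2] are the neutrices of the derivatives of [phi] and [F].  Given [eps] above it, one
needs [e1 > K1] and [e2 > K2] making the error smaller than [eps].  This is
where one factor must be zeroless: if, say, [d] is outside [K1], then [e1] may
be taken at most [|d|], so that [e1 e2 <= |d| e2] and it suffices to make
[|c| e1] and [|d| e2] small, which is a linear condition on each of [e1] and
[e2] (lemma [small_radii]).  With two neutrices as derivatives, only
[eps > K1 K2] would be known, and this need not provide [e1 > K1] and [e2 > K2]
with [e1 e2 < eps].

To use the derivatives through epsilon and delta, the intersection defining an
outer limit must itself satisfy the limit condition: a real above its neutrix is
already above the neutrix of one of the intersected limits (lemma
[outer_limit_attained]).  The estimate then shows that the product of the
derivatives is one of the external numbers intersected in the derivative of the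
composite, whence the inclusion.  For this the product must be an external
number: its neutrix part must be definable in the language of set theory with a
standardness predicate (lemma [definable_nprod]), and it must be a proper convex
subgroup (lemma [neutrix_of_dom]). *)

(** * Definability *)

Section Definability.
Variable I : ist_model.

(** Working with predicates on environments instead of formulas lets the
    set-theoretic definitions be translated by following their syntax. *)
Definition expressible (P : (nat -> I) -> Prop) : Prop :=
  exists f, forall e, P e <-> sat (@imem I) (@ist I) e f.

Lemma expressible_mem i j : expressible (fun e => imem (e i) (e j)).
Proof. by exists (FMem i j). Qed.

Lemma expressible_eq i j : expressible (fun e => e i = e j).
Proof. by exists (FEq i j). Qed.

Lemma expressible_imp P Q :
  expressible P -> expressible Q -> expressible (fun e => P e -> Q e).
Proof.
move=> [f fP] [g gQ]; exists (FImp f g) => e /=.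
by split=> PQ He; apply/gQ/PQ/fP.
Qed.

(** De Bruijn index 0 is the bound variable, so the environment of the body is
    read off as its entry 0 followed by the ambient environment. *)
Lemma expressible_all (Q : I -> (nat -> I) -> Prop) :
  expressible (fun e => Q (e 0%N) (fun n => e n.+1)) ->
  expressible (fun e => forall x, Q x e).
Proof.
by move=> [f fQ]; exists (FAll f) => e /=; split=> H x; apply/(fQ (scons x e))/H.
Qed.

Lemma expressible_ext P Q :
  (forall e, P e <-> Q e) -> expressible P -> expressible Q.
Proof. by move=> PQ [f fP]; exists f => e; rewrite -PQ. Qed.

Lemma expressible_not P : expressible P -> expressible (fun e => ~ P e).
Proof. by move=> eP; apply: expressible_imp => //; exists FFalse. Qed.

Lemma expressible_and P Q :
  expressible P -> expressible Q -> expressible (fun e => P e /\ Q e).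
Proof.
move=> eP eQ; apply: (@expressible_ext (fun e => ~ (P e -> ~ Q e))).
  by move=> e; rewrite not_implyE not_notE.
exact/expressible_not/expressible_imp/expressible_not.
Qed.

Lemma expressible_or P Q :
  expressible P -> expressible Q -> expressible (fun e => P e \/ Q e).
Proof.
move=> eP eQ; apply: (@expressible_ext (fun e => ~ P e -> Q e)).
  by move=> e; rewrite implyE not_notE.
exact/expressible_imp/eQ/expressible_not.
Qed.

Lemma expressible_iff P Q :
  expressible P -> expressible Q -> expressible (fun e => P e <-> Q e).
Proof. by move=> eP eQ; apply: expressible_and; apply: expressible_imp. Qed.

Lemma expressible_ex (Q : I -> (nat -> I) -> Prop) :
  expressible (fun e => Q (e 0%N) (fun n => e n.+1)) ->
  expressible (fun e => exists x, Q x e).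
Proof.
move=> eQ; apply: (@expressible_ext (fun e => ~ forall x, ~ Q x e)).
  by move=> e; rewrite -existsNE; split=> -[x] H; exists x => //; apply: contrapT.
by apply/expressible_not/expressible_all/expressible_not.
Qed.

Lemma expressible_upair p x y :
  expressible (fun e => is_upair (@imem I) (e p) (e x) (e y)).
Proof.
apply: expressible_all; apply: expressible_iff; first exact: expressible_mem.
by apply: expressible_or; apply: expressible_eq.
Qed.

Lemma expressible_pair p x y :
  expressible (fun e => is_pair (@imem I) (e p) (e x) (e y)).
Proof.
apply: expressible_all; apply: expressible_iff; first exact: expressible_mem.
by apply: expressible_or; apply: expressible_upair.
Qed.

Lemma expressible_rel3 g x y z :
  expressible (fun e => rel3 (@imem I) (e g) (e x) (e y) (e z)).
Proof.
apply: expressible_ex; apply: expressible_ex.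
apply: (@expressible_ext (fun e => is_pair (@imem I) (e 1%N) (e x.+2) (e y.+2) /\
  (is_pair (@imem I) (e 0%N) (e 1%N) (e z.+2) /\ imem (e 0%N) (e g.+2)))).
  by move=> e; split=> [[? []]|[]].
apply: expressible_and; first exact: expressible_pair.
by apply: expressible_and; [apply: expressible_pair|apply: expressible_mem].
Qed.

(** Action of a renaming under a binder: index 0 stays bound. *)
Definition lift_index (r : nat -> nat) (n : nat) : nat :=
  if n is m.+1 then (r m).+1 else 0%N.

Fixpoint rename (r : nat -> nat) (f : formula) : formula :=
  match f with
  | FMem i j => FMem (r i) (r j)
  | FEq i j => FEq (r i) (r j)
  | FSt i => FSt (r i)
  | FFalse => FFalse
  | FImp g h => FImp (rename r g) (rename r h)
  | FAll g => FAll (rename (lift_index r) g)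
  end.

Lemma sat_rename (f : formula) (r : nat -> nat) (e : nat -> I) :
  sat (@imem I) (@ist I) e (rename r f) <->
  sat (@imem I) (@ist I) (fun n => e (r n)) f.
Proof.
elim: f r e => //= [g IHg h IHh|g IHg] r e; first by rewrite IHg IHh.
have E x : (fun n => scons x e (lift_index r n)) = scons x (fun n => e (r n)).
  by apply/funext => -[].
by split=> H x; move: (H x); rewrite IHg E.
Qed.

Lemma expressible_sat (f : formula) (r : nat -> nat) :
  expressible (fun e => sat (@imem I) (@ist I) (fun n => e (r n)) f).
Proof. by exists (rename r f) => e; rewrite sat_rename. Qed.

(** Two definable sets come with two infinite parameter lists; interleaving them,
    behind two further parameters, gives one list for a combined formula. *)
Definition join_env (u v : I) (e1 e2 : nat -> I) (n : nat) : I :=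
  match n with
  | 0%N => u
  | 1%N => v
  | m.+2 => if odd m then e2 m./2 else e1 m./2
  end.

Lemma join_env_left u v e1 e2 n : join_env u v e1 e2 n.*2.+2 = e1 n.
Proof. by rewrite /= odd_double doubleK. Qed.

Lemma join_env_right u v e1 e2 n : join_env u v e1 e2 n.*2.+3 = e2 n.
Proof. by rewrite /= odd_double /= uphalf_double. Qed.

Variable R : ist_reals I.

Lemma definable_set1 (x : R) : definable [set x].
Proof.
exists (FEq 0 1), (fun=> emb x) => y /=; split=> [-> //|]; exact: emb_inj.
Qed.

Lemma definable_union (A B : set R) :
  definable A -> definable B -> definable (A `|` B).
Proof.
move=> [f [e1 fA]] [g [e2 gB]].
pose r1 n := if n is m.+1 then (m.*2.+2).+1 else 0%N.
pose r2 n := if n is m.+1 then (m.*2.+3).+1 else 0%N.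
have [h hE] := expressible_or (expressible_sat f r1) (expressible_sat g r2).
exists h, (join_env (rset R) (rset R) e1 e2) => x.
rewrite -hE.
have -> : (fun n => scons (emb x) (join_env (rset R) (rset R) e1 e2) (r1 n)) =
    scons (emb x) e1.
  by apply/funext => -[|n] //; apply: join_env_left.
have -> : (fun n => scons (emb x) (join_env (rset R) (rset R) e1 e2) (r2 n)) =
    scons (emb x) e2.
  by apply/funext => -[|n] //; apply: join_env_right.
by rewrite -fA -gB.
Qed.

(** The product is described inside the model by the set [rmul].  Nothing is
    assumed about [rmul] outside the reals, so the two factors have to be
    restricted to [rset]. *)
Lemma definable_nprod (A B : set R) :
  definable A -> definable B -> definable (nprod A B).
Proof.
move=> [f [e1 fA]] [g [e2 gB]].
(* The environment is u, v, z, rset, rmul, followed by the entries of e1 and e2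
   in alternation; index 0 of f and of g becomes u and v. *)
pose r1 n := if n is m.+1 then (m.*2.+2).+3 else 0%N.
pose r2 n := if n is m.+1 then (m.*2.+3).+3 else 1%N.
have [h hE] : expressible (fun e => exists v u,
   (imem u (e 1%N) /\ imem v (e 1%N)) /\
   (rel3 (@imem I) (e 2%N) u v (e 0%N) /\
   (sat (@imem I) (@ist I) (fun n => scons u (scons v e) (r1 n)) f /\
    sat (@imem I) (@ist I) (fun n => scons u (scons v e) (r2 n)) g))).
  apply: expressible_ex; apply: expressible_ex.
  have E (e : nat -> I) : scons (e 0%N) (scons (e 1%N) (fun n => e n.+2)) = e.
    by apply/funext => -[|[|n]].
  apply: expressible_and.
    by apply: expressible_and; apply: expressible_mem.
  apply: expressible_and; first exact: expressible_rel3.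
  apply: expressible_and.
    by apply: (expressible_ext _ (expressible_sat f r1)) => e; rewrite E.
  by apply: (expressible_ext _ (expressible_sat g r2)) => e; rewrite E.
exists h, (join_env (rset R) (rmul R) e1 e2) => z.
rewrite -hE.
have env1 u v : (fun n => scons u (scons v (scons (emb z)
    (join_env (rset R) (rmul R) e1 e2))) (r1 n)) = scons u e1.
  by apply/funext => -[|n] //; apply: join_env_left.
have env2 u v : (fun n => scons u (scons v (scons (emb z)
    (join_env (rset R) (rmul R) e1 e2))) (r2 n)) = scons v e2.
  by apply/funext => -[|n] //; apply: join_env_right.
split=> [[x Ax [y By xyz]]|[v [u [[/rsetP[x ux] /rsetP[y vy]] [uvz]]]]].
  exists (emb y), (emb x); rewrite env1 env2 -fA -gB; split.
    by split; apply/rsetP; [exists x|exists y].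
  by split=> //; apply/rmulP.
rewrite env1 env2 ux vy -fA -gB => -[Ax By].
by exists x => //; exists y => //; apply/rmulP; rewrite -ux -vy.
Qed.

End Definability.

(** * Neutrices *)

Section Neutrices.
Variables (I : ist_model) (R : ist_reals I).
Implicit Types (A B : set R) (x y e : R).

Lemma set_lt1P A e : set_lt A [set e] <-> forall x, A x -> x < e.
Proof. by split=> [H x Ax|H x _ Ax ->]; apply: H. Qed.

Lemma neutrixN A x : neutrix A -> A x -> A (- x).
Proof. by move=> nA Ax; rewrite -sub0r; apply: (neutrixB nA) (neutrix0 nA) Ax. Qed.

Lemma neutrixD A x y : neutrix A -> A x -> A y -> A (x + y).
Proof.
by move=> nA Ax Ay; rewrite -[y]opprK; apply: (neutrixB nA) Ax _; apply: neutrixN.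
Qed.

Lemma neutrix_norm A x : neutrix A -> A x -> A `|x|.
Proof. by move=> nA Ax; case: (ger0P x) => _ //; apply: neutrixN. Qed.

(** Doubling covers the subgroup property, and the comparison of absolute values
    covers convexity and symmetry: a single closure property replaces both. *)
Lemma neutrix_dom A x y : neutrix A -> A x -> `|y| <= `|x| *+ 2 -> A y.
Proof.
move=> nA Ax; have A2 : A (`|x| *+ 2).
  by rewrite mulr2n; apply: neutrixD => //; apply: neutrix_norm.
by rewrite ler_norml; apply: (neutrix_convex nA) => //; apply: neutrixN.
Qed.

Lemma neutrix_lt A x y : neutrix A -> ~ A y -> A x -> x < `|y|.
Proof.
move=> nA nAy Ax; rewrite ltNge; apply/negP => yx; apply: nAy.
apply: (neutrix_dom nA Ax); apply: le_trans yx _.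
by rewrite mulr2n; apply: le_trans (ler_norm x) _; rewrite lerDl.
Qed.

Lemma neutrix_set_lt A y : neutrix A -> ~ A y -> set_lt A [set `|y|].
Proof. by move=> nA nAy; apply/set_lt1P => x; apply: neutrix_lt. Qed.

Lemma set_lt_gt0 A e : neutrix A -> set_lt A [set e] -> 0 < e.
Proof. by move=> nA /set_lt1P Ae; apply: Ae; apply: neutrix0. Qed.

Lemma set_lt_quarter A e : neutrix A -> set_lt A [set e] -> set_lt A [set e / 4].
Proof.
move=> nA /set_lt1P Ae; apply/set_lt1P => x Ax.
by have := Ae _ (neutrixD nA (neutrixD nA Ax Ax) (neutrixD nA Ax Ax)); lra.
Qed.

Lemma set_lt_min A e e' :
  set_lt A [set e] -> set_lt A [set e'] -> set_lt A [set Num.min e e'].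
Proof.
move=> /set_lt1P Ae /set_lt1P Ae'; apply/set_lt1P => x Ax.
by rewrite lt_min Ae // Ae'.
Qed.

Lemma neutrix_bounded A : neutrix A -> exists2 r, 0 < r & forall x, A x -> `|x| <= r.
Proof.
move=> nA; have [r nAr] : exists r, ~ A r.
  apply: contrapT => H; apply: (neutrix_proper nA); apply/seteqP; split=> // x _.
  by apply: contrapT => nAx; apply: H; exists x.
exists `|r|; first by apply: set_lt_gt0 (neutrix_set_lt nA nAr).
move=> x Ax; apply: ltW; apply: (neutrix_lt nA nAr).
exact: neutrix_norm.
Qed.

(** Converse of [neutrix_dom].  Unlike the separate subgroup and convexity
    conditions, this closure property passes directly to unions and products. *)
Lemma neutrix_of_dom A r : definable A -> A 0 ->
  (forall x y, A x -> `|y| <= `|x| *+ 2 -> A y) ->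
  (forall x, A x -> `|x| <= r) -> neutrix A.
Proof.
move=> defA A0 Adom Ar; split=> //.
- move=> x y Ax Ay; have [xy|yx] := leP `|x| `|y|.
    by apply: (Adom _ _ Ay); apply: le_trans (ler_normB _ _) _; rewrite mulr2n lerD.
  by apply: (Adom _ _ Ax); apply: le_trans (ler_normB _ _) _; rewrite mulr2n lerD // ltW.
- move=> x y z Ax Ay /andP[xz zy].
  have zxy : `|z| <= `|x| \/ `|z| <= `|y|.
    have [z0|z0] := leP 0 z.
      by right; rewrite ger0_norm //; apply: le_trans zy (ler_norm y).
    by left; rewrite ltr0_norm // -normrN; apply: le_trans (ler_norm (- x)); rewrite lerN2.
  by case: zxy => zu; [apply: (Adom _ _ Ax)|apply: (Adom _ _ Ay)];
    apply: le_trans zu _; rewrite mulr2n lerDl.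
- move=> AT; have: A (`|r| + 1) by rewrite AT.
  by move/Ar; rewrite ger0_norm ?addr_ge0 //; have := ler_norm r; lra.
Qed.

Lemma neutrix_nmax A B : neutrix A -> neutrix B -> neutrix (nmax A B).
Proof.
move=> nA nB; have [r r0 Ar] := neutrix_bounded nA.
have [s s0 Bs] := neutrix_bounded nB.
apply: (@neutrix_of_dom _ (r + s)).
- by apply: definable_union; apply: neutrix_def.
- by left; apply: neutrix0.
- by move=> x y [Ax|Bx] xy; [left; apply: neutrix_dom xy|right; apply: neutrix_dom xy].
- by move=> x [/Ar|/Bs]; lra.
Qed.

Lemma neutrix_nprod A B : neutrix A -> neutrix B -> neutrix (nprod A B).
Proof.
move=> nA nB; have [r r0 Ar] := neutrix_bounded nA.
have [s s0 Bs] := neutrix_bounded nB.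
apply: (@neutrix_of_dom _ (r * s)).
- by apply: definable_nprod; apply: neutrix_def.
- by exists 0; [apply: neutrix0|exists 0; [apply: neutrix0|rewrite mul0r]].
- move=> _ z [x Ax [y By <-]]; have [->|y0] := eqVneq y 0.
    rewrite mulr0 normr0 mul0rn normr_le0 => /eqP ->.
    by exists 0; [apply: neutrix0|exists 0; [apply: neutrix0|rewrite mul0r]].
  move=> zxy; exists (z / y); last by exists y; rewrite ?divfK.
  apply: (neutrix_dom nA Ax).
  by rewrite normrM normfV ler_pdivrMr ?normr_gt0 // mulrnAl -normrM.
- move=> _ [x Ax [y By <-]]; rewrite normrM.
  by apply: ler_pM; rewrite ?normr_ge0 // ?Ar ?Bs.
Qed.

Lemma neutrix_nscale x A : neutrix A -> neutrix (nscale x A).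
Proof.
move=> nA; have [r r0 Ar] := neutrix_bounded nA.
have xA0 : nscale x A 0 by exists 0; [apply: neutrix0|rewrite mulr0].
apply: (@neutrix_of_dom _ (`|x| * r)) => //.
- have -> : nscale x A = nprod [set x] A.
    apply/seteqP; split=> [_ [y Ay <-]|_ [_ -> [y Ay <-]]]; last by exists y.
    by exists x => //; exists y.
  exact: definable_nprod (definable_set1 x) (neutrix_def nA).
- move=> _ z [y Ay <-]; have [x0|x0] := eqVneq x 0.
    by rewrite {1}x0 mul0r normr0 mul0rn normr_le0 => /eqP ->.
  move=> zxy; exists (x^-1 * z); last by rewrite mulVKf.
  apply: (neutrix_dom nA Ay).
  by rewrite mulrC normrM normfV ler_pdivrMr ?normr_gt0 // mulrnAl -normrM mulrC.
- by move=> _ [y Ay <-]; rewrite normrM ler_wpM2l // Ar.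
Qed.

Lemma external_emul (al be : extnum R) : external_number al ->
  external_number be -> external_number (emul al be).
Proof.
move=> nal nbe; apply: neutrix_nmax; first exact: neutrix_nscale.
by apply: neutrix_nmax; [apply: neutrix_nscale|apply: neutrix_nprod].
Qed.

Lemma eset_neut (al : extnum R) x : eset al x <-> neut al (x - rep al).
Proof.
split=> [[y ny <-]|nx]; first by rewrite addrC addKr.
by exists (x - rep al); rewrite // addrC subrK.
Qed.

Lemma zeroless_rep (al : extnum R) :
  external_number al -> zeroless al -> ~ neut al (rep al).
Proof.
by move=> nal zal nr; apply: zal; apply/eset_neut; rewrite sub0r; apply: neutrixN.
Qed.

Lemma eabs_esub_lt (al be : extnum R) e :
  set_lt (eset (eabs (esub al be))) [set e] <->
  forall x, neut al x \/ neut be x -> `|rep al - rep be| + x < e.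
Proof.
rewrite set_lt1P; split=> [H x nx|H _ [x nx <-]]; last exact: H.
by apply: H; exists x.
Qed.

Lemma set_lt_div c A e : neutrix A -> c != 0 ->
  set_lt (nscale c A) [set e] -> set_lt A [set e / `|c|].
Proof.
move=> nA c0 /set_lt1P cAe; apply/set_lt1P => x Ax.
rewrite ltr_pdivlMr ?normr_gt0 //; case: (ger0P c) => _.
  by rewrite mulrC; apply: cAe; exists x.
rewrite mulrN -mulNr mulrC; apply: cAe; exists (- x) => //; exact: neutrixN.
Qed.

(** Once [e1 <= |d|], the mixed term [e1 * e2] is absorbed by [|d| * e2], and
    what remains is to make [|c| * e1] and [|d| * e2] small, one condition on
    each radius, which can be met because [e] is above [c A] and [d B].  When [d] belongs to [A], every [e1] beyond
    [A] exceeds [|d|], and this absorption is impossible. *)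
Lemma small_radii A B c d e : neutrix A -> neutrix B -> ~ A d ->
  set_lt (nscale c A) [set e] -> set_lt (nscale d B) [set e] ->
  exists e1 e2, [/\ set_lt A [set e1], set_lt B [set e2] &
    e1 * e2 + `|c| * e1 + `|d| * e2 < e].
Proof.
move=> nA nB nAd cAe dBe.
have d0 : d != 0 by apply/eqP => d0; apply: nAd; rewrite d0; apply: neutrix0.
have e0 : 0 < e := set_lt_gt0 (neutrix_nscale d nB) dBe.
have Be2 : set_lt B [set e / 4 / `|d|].
  by apply: set_lt_div => //; apply: set_lt_quarter dBe; apply: neutrix_nscale.
have [e1 [Ae1 e1d ce1]] :
    exists e1, [/\ set_lt A [set e1], e1 <= `|d| & `|c| * e1 <= e / 4].
  have Ad := neutrix_set_lt nA nAd.
  have [c0|c0] := eqVneq c 0.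
    by exists `|d|; split=> //; rewrite c0 normr0 mul0r; lra.
  exists (Num.min `|d| (e / 4 / `|c|)); split.
  - apply: set_lt_min => //; apply: set_lt_div => //.
    by apply: set_lt_quarter cAe; apply: neutrix_nscale.
  - by rewrite ge_min lexx.
  - by rewrite mulrC -ler_pdivlMr ?normr_gt0 // ge_min lexx orbT.
(* Each of the three terms is at most e / 4. *)
exists e1, (e / 4 / `|d|); split=> //.
have de2 : `|d| * (e / 4 / `|d|) = e / 4 by rewrite mulrC divfK ?normr_eq0.
have : e1 * (e / 4 / `|d|) <= e / 4.
  by rewrite -[leRHS]de2 ler_wpM2r //; apply: ltW; apply: set_lt_gt0 Be2.
by rewrite de2; lra.
Qed.

End Neutrices.

(** * Outer limits *)

Section Limits.
Variables (I : ist_model) (R : ist_reals I).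

(** Suppose [eps] is above the neutrix of the intersection [al].  Then
    [rep al + eps / 4] is not in the intersection, so some limit [be] misses it;
    [be] contains [rep al], hence [eps / 4] is above the neutrix of [be], and the
    limit condition for [be] at [eps / 4] gives that for [al] at [eps]. *)
Lemma outer_limit_attained (X : set R) (H : R -> extnum R) (a : R) (M : set R)
    (al : extnum R) : external_number al ->
  outer_limit X H a M = eset al -> outer_limit_candidate X H a M al.
Proof.
move=> nal limal; split=> // eps al_eps.
have al_eps4 := set_lt_quarter nal al_eps.
have eps0 := set_lt_gt0 nal al_eps4.
have [be [[nbe limbe] be_eps]] :
    exists be, outer_limit_candidate X H a M be /\ ~ eset be (rep al + eps / 4).
  apply: contrapT => no; have : outer_limit X H a M (rep al + eps / 4).
    by move=> be cbe; apply: contrapT => nbe; apply: no; exists be.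
  rewrite limal eset_neut addrAC subrr add0r.
  by move/(set_lt1P _ _).1: al_eps4 => /[apply]; rewrite ltxx.
have sub x : eset al x -> eset be x by rewrite -limal; apply.
have be_al : neut be (rep al - rep be).
  by apply/eset_neut/sub/eset_neut; rewrite subrr; apply: neutrix0.
have subN x : neut al x -> neut be x.
  move=> nx; have /sub/eset_neut : eset al (rep al + x).
    by apply/eset_neut; rewrite addrAC subrr add0r.
  move/(neutrixB nbe) => /(_ _ be_al).
  by have -> : rep al + x - rep be - (rep al - rep be) = x by ring.
have lt_eps : set_lt (neut be) [set eps / 4].
  rewrite -[eps / 4]gtr0_norm //; apply: neutrix_set_lt => // neps.
  apply: be_eps; apply/eset_neut; rewrite addrAC; exact: neutrixD.
have [delta M_delta Hdelta] := limbe _ lt_eps.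
exists delta => // x Xx Mx x_delta.
have /eabs_esub_lt Hx := Hdelta _ Xx Mx x_delta.
apply/eabs_esub_lt => k nk.
have /Hx k_eps : neut (H x) k \/ neut be k by case: nk => [|/subN]; [left|right].
have := (set_lt1P _ _).1 lt_eps _ (neutrix_norm nbe be_al).
have := ler_distD (rep be) (rep (H x)) (rep al).
rewrite [`|rep be - _|]distrC; lra.
Qed.

End Limits.

(** * The chain rule *)

(** The term [m * p] accounts for the neutrix part of the quotient of the
    composite, which is that of the quotient of [F] scaled by [p]. *)
Lemma chain_estimate (T : realFieldType) (c d p q m e1 e2 : T) :
  `|p - d| <= e1 -> `|q - c| + `|m| <= e2 ->
  `|q * p - c * d| + `|m * p| <= e1 * e2 + `|c| * e1 + `|d| * e2.
Proof.
move=> pd qc.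
have -> : q * p - c * d = (q - c) * (p - d) + c * (p - d) + (q - c) * d by ring.
have -> : m * p = m * (p - d) + m * d by ring.
have h1 := ler_normD ((q - c) * (p - d) + c * (p - d)) ((q - c) * d).
have h2 := ler_normD ((q - c) * (p - d)) (c * (p - d)).
have h3 := ler_normD (m * (p - d)) (m * d).
have h4 : (`|q - c| + `|m|) * `|p - d| <= e2 * e1.
  by apply: ler_pM; rewrite ?addr_ge0.
have h5 : `|c| * `|p - d| <= `|c| * e1 by rewrite ler_wpM2l.
have h6 : `|d| * (`|q - c| + `|m|) <= `|d| * e2 by rewrite ler_wpM2l.
rewrite !normrM in h1 h2 h3.
lra.
Qed.

Theorem theorem5p5 (I : ist_model) (R : ist_reals I)
    (a : R) (M N : set R) (hM : neutrix M) (hN : neutrix N)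
    (phi : R -> R) (hphi : flexible setT (real_fun phi))
    (X : set R) (F : R -> extnum R) (hF : flexible X F)
    (dphi : differentiable M setT (real_fun phi) a)
    (hint : interior_point N (phi a) X)
    (hlim_ex : outer_limit_exists setT (real_fun phi) a M)
    (hlim : outer_limit setT (real_fun phi) a M = eset (ExtNum (phi a) N))
    (U : set R) (hU : outer_neighborhood M a U) (hUX : U `<=` X)
    (hUN : forall x, U x -> ~ eset (ExtNum (phi a) N) (phi x))
    (dF : differentiable N X F (phi a))
    (Dphi DF : extnum R)
    (hDphi : external_number Dphi) (hDF : external_number DF)
    (hDphiE : derivative M setT (real_fun phi) a = eset Dphi)
    (hDFE : derivative N X F (phi a) = eset DF)
    (hzl : zeroless Dphi \/ zeroless DF) :
  differentiable M (phi @^-1` X) (F \o phi) a /\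
  derivative M (phi @^-1` X) (F \o phi) a `<=` eset (emul DF Dphi).
Proof.
have [_ lim_phi] := outer_limit_attained (al := ExtNum (phi a) N) hN hlim.
have [_ lim_Dphi] := outer_limit_attained hDphi hDphiE.
have [_ lim_DF] := outer_limit_attained hDF hDFE.
suff cand : outer_limit_candidate (diff_quot_dom (phi @^-1` X) a)
    (diff_quot (F \o phi) a) a M (emul DF Dphi).
  split; last by move=> x; apply.
  by split; [exact: dF.1|exists (emul DF Dphi)].
have nE : neutrix (neut (emul DF Dphi)) := external_emul hDF hDphi.
(* The margin between eps / 4 and eps absorbs the neutrix parts. *)
split=> // eps /(set_lt_quarter nE) eps4.
have [e1 [e2 [Dphi_e1 DF_e2 e12]]] : exists e1 e2,
    [/\ set_lt (neut Dphi) [set e1], set_lt (neut DF) [set e2] &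
    e1 * e2 + `|rep DF| * e1 + `|rep Dphi| * e2 < eps / 4].
  have DFK : set_lt (nscale (rep DF) (neut Dphi)) [set eps / 4].
    by move=> s t As; apply: eps4; left.
  have DphiK : set_lt (nscale (rep Dphi) (neut DF)) [set eps / 4].
    by move=> s t As; apply: eps4; right; left.
  case: hzl => zl; first exact: small_radii (zeroless_rep hDphi zl) DFK DphiK.
  have [e2 [e1 [? ? e12]]] := small_radii hDF hDphi (zeroless_rep hDF zl) DphiK DFK.
  by exists e1, e2; split=> //; rewrite [e1 * e2]mulrC addrAC.
have [dF' N_dF' HF] := lim_DF _ DF_e2.
have [d1 M_d1 Hphi] := lim_phi _ N_dF'.
have [d2 M_d2 HDphi] := lim_Dphi _ Dphi_e1.
have [V [_ [r M_r rV]] UE] := hU.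
exists (Num.min r (Num.min d1 d2)); first by do 2!apply: set_lt_min => //.
move=> x [Xx xa] Mx; rewrite !lt_min => /and3P[x_r x_d1 x_d2].
have Ux : U x.
  rewrite UE; split; first by apply: rV; rewrite -ltr_distl.
  move/eset_neut/(neutrix_norm hM) => Mxa.
  by have := (set_lt1P _ _).1 Mx _ Mxa; rewrite ltxx.
have N_phi : ~ N (phi x - phi a) by move=> Nphi; apply: (hUN x Ux); apply/eset_neut.
have phixa : phi x <> phi a.
  by move=> E; apply: N_phi; rewrite E subrr; apply: neutrix0.
have /eabs_esub_lt phi_lt := Hphi x Logic.I Mx x_d1.
have {}phi_lt : `|phi x - phi a| < dF'.
  by have := phi_lt 0 (or_intror (neutrix0 hN)); rewrite addr0.
have /eabs_esub_lt q_lt := HF (phi x) (conj Xx phixa) (neutrix_set_lt hN N_phi) phi_lt.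
have /eabs_esub_lt p_lt := HDphi x (conj Logic.I xa) Mx x_d2.
set p := (phi x - phi a) / (x - a).
set q := (rep (F (phi x)) - rep (F (phi a))) / (phi x - phi a).
have xa0 : x - a != 0 by rewrite subr_eq0; apply/eqP.
have phixa0 : phi x - phi a != 0 by rewrite subr_eq0; apply/eqP.
have pd : `|p - rep Dphi| <= e1.
  by have := p_lt 0 (or_intror (neutrix0 hDphi)); rewrite addr0 => /ltW.
have qpE : rep (diff_quot (F \o phi) a x) = q * p.
  by rewrite /q /p mulrA divfK.
apply/eabs_esub_lt; rewrite qpE => k [[n nF <-]|nk].
  have qm : `|q - rep DF| + `|(phi x - phi a)^-1 * n| <= e2.
    have nF' : neutrix (nmax (neut (F (phi x))) (neut (F (phi a)))).
      by apply: neutrix_nmax; apply: (flexible_val hF) => //; exact: dF.1.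
    apply/ltW/q_lt; left; apply: (neutrix_norm (neutrix_nscale _ nF')).
    by exists n.
  have := chain_estimate pd qm.
  have -> : (phi x - phi a)^-1 * n * p = (x - a)^-1 * n.
    by rewrite /p mulrAC mulKf.
  have := ler_norm ((x - a)^-1 * n).
  have := set_lt_gt0 nE eps4; rewrite [rep (emul _ _)]/=; lra.
have qc : `|q - rep DF| + `|0 : R| <= e2.
  by apply/ltW/q_lt; right; rewrite normr0; apply: neutrix0.
have := chain_estimate pd qc; rewrite mul0r normr0 addr0.
have := (set_lt1P _ _).1 eps4 _ nk.
have := set_lt_gt0 nE eps4; rewrite [rep (emul _ _)]/=; lra.
Qed.
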